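(* For each $\kappa \in (-\infty,\infty)$, let $$A_\kappa := \{ x \in (0,1] : \log d_n(x) \geq \kappa n \text{ for all } n \in \mathbb{N} \}.$$ Then, for each $\kappa \in (-\infty,\infty)$, $\dim_H A_\kappa = 1$.
   Context: Pierce expansion digits: for $x \in (0,1]$ put $d_1(x) := \lfloor 1/x \rfloor$ and $T(x) := 1 - d_1(x)x$, and for $k \in \mathbb{N}$ put $d_k(x) := d_1(T^{k-1}(x))$ provided $T^{k-1}(x) \neq 0$. All digits $d_k(x)$, $k \in \mathbb{N}$, are defined exactly when $x$ is irrational, and then they form a strictly increasing sequence of positive integers. Convention: a limiting condition on $(d_n(x))_n$, or a condition for all (large) $n$, is only considered for irrational $x$, so rational $x$ do not belong to sets defined by such conditions. $\mathbb{N}=\{1,2,\dots\}$, $\log$ is the natural logarithm, and $\dim_H$ is the Hausdorff dimension. *)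

(* Defs.v *)
From HB Require Import structures.
From mathcomp Require Import all_boot all_order all_algebra.
From mathcomp Require Import all_classical all_reals all_analysis.

Set Implicit Arguments.
Unset Strict Implicit.
Unset Printing Implicit Defensive.

Import Order.TTheory GRing.Theory Num.Theory.
Import numFieldNormedType.Exports.

Local Open Scope classical_set_scope.
Local Open Scope ring_scope.

Section HausdorffDimension.
Context {R : realType}.
Local Open Scope ereal_scope.

(* [diam set0 = -oo], since [ereal_sup set0 = -oo]. *)
Definition diam (U : set R) : \bar R :=
  ereal_sup [set `|p.1 - p.2|%:E | p in U `*` U].

(* The empty set is given size 0 even for [s = 0]; a nonempty set of diameter 0
   has size 1 for [s = 0], so that the case [s = 0] is the counting measure. *)
Definition diam_pow (s : R) (U : set R) : \bar R :=
  if U == set0 then 0 else poweR (diam U) s.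

(* Finite covers are included, since the [U i] may be empty. *)
Definition hausdorff_premeasure (s delta : R) (E : set R) : \bar R :=
  ereal_inf [set \sum_(0 <= i <oo) diam_pow s (U i) | U in
    [set U : (set R)^nat | E `<=` \bigcup_i U i /\
                           forall i, diam (U i) <= delta%:E]].

(* The limit as [delta] tends to [0] from the right is a supremum, because
   [hausdorff_premeasure s delta E] is nonincreasing in [delta]. *)
Definition hausdorff_measure (s : R) (E : set R) : \bar R :=
  ereal_sup [set hausdorff_premeasure s delta E |
    delta in [set delta : R | (0 < delta)%R]].

Definition hausdorff_dim (E : set R) : \bar R :=
  ereal_inf [set s%:E | s in
    [set s : R | (0 <= s)%R /\ hausdorff_measure s E = 0]].

End HausdorffDimension.

Section PierceExpansion.
Context {R : realType}.

Definition pierce_digit1 (x : R) : int := Num.floor (x^-1).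

Definition pierce_map (x : R) : R := 1 - (pierce_digit1 x)%:~R * x.

(* Meaningful for [0 < n] and [iter n.-1 pierce_map x != 0] only, the latter
   holding for all [n] when [x] is irrational; otherwise a junk value. *)
Definition pierce_digit (n : nat) (x : R) : int :=
  pierce_digit1 (iter n.-1 pierce_map x).

(* Irrationality is what makes all the digits of [x] defined. *)
Definition pierce_exp_growth (kappa : R) : set R :=
  [set x | [/\ 0 < x <= 1, irrational x &
    forall n : nat, (0 < n)%N -> kappa * n%:R <= ln (pierce_digit n x)%:~R]].

End PierceExpansion.

(* Main.v *)
Require Import Defs.
From mathcomp Require Import all_boot all_order all_algebra.
From mathcomp Require Import all_classical all_reals all_analysis.
From mathcomp Require Import ring lra zify.

(** The upper bound is the usual one: for [s > 1], about [N] intervals of length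
    [1/N] cover the unit interval at cost [N * N^-s], which tends to [0]
    ([hausdorff_measure_itv_eq0]).

    For the lower bound, fix an integer [M >= max 4 (exp kappa)] and keep only
    the points whose [n]-th digit lies in the window [[M^n, 2 M^n)], for every
    [n]. Such digits increase strictly and satisfy [log d_n >= kappa n], so the
    points belong to the set under study. There are [M^n] choices for the [n]-th
    digit, hence the points correspond to the reals [u] of [[0, 1)] through
    the expansion of [u] in the mixed radix system with bases [M, M^2, M^3, ...].
    This is the map [window_point].

    Compare distances on both sides. If [u] and [v] first differ at the digit of
    index [n] (counting from [0]), then with [P = n (n + 1) / 2]
    - [|u - v| <= M^-P], the length of the common mixed radix cell;
    - the images are at distance at least [M^-(P + 3 n + 4)]: the common digits
      contract distances by the inverse of their product, which is at most
      [M^(P + n)], and the two Pierce cells reached after them are separated by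
      a gap, because the next digits are large and keep the points away from one
      end of these cells ([window_tail_separation]).
    Since [P] is quadratic in [n] and the loss [3 n + 4] only linear, for every
    [s < 1] we get [|u - v| <= C |window_point u - window_point v|^s]
    ([window_point_holder]). Thus a cover of the image by sets [U_i] pulls back
    to a cover of [[0, 1)] by sets of length at most a constant times
    [diam(U_i)^s], and countable subadditivity of Lebesgue measure bounds the
    [s]-dimensional sum from below ([hausdorff_measure_gt0]).

    That the sequences of digits are realised is a matter of summing the Pierce
    series [1/d_0 - 1/(d_0 d_1) + ...]: it satisfies [x = (1 - x') / d_0], with
    [x'] the series of the shifted digits, so [pierce_map] acts as the shift.
    All its iterates are then positive, which forces irrationality: on a
    rational point [pierce_map] keeps the denominator and lowers the numerator
    ([irrational_pierce_orbit]). *)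

Set Implicit Arguments.
Unset Strict Implicit.
Unset Printing Implicit Defensive.

Import Order.TTheory GRing.Theory Num.Theory.
Import numFieldNormedType.Exports.

Local Open Scope classical_set_scope.
Local Open Scope ring_scope.

(** * Hausdorff measure and dimension on the line *)

Section Hausdorff.
Context {R : realType}.
Implicit Types (s delta : R) (U E : set R).
Local Open Scope ereal_scope.

Lemma diam_pow_ge0 s U : 0 <= diam_pow s U.
Proof. by rewrite /diam_pow; case: ifP => // _; exact: poweR_ge0. Qed.

Lemma diam_ge_dist U x y : U x -> U y -> (`|x - y|%R)%:E <= diam U.
Proof. by move=> Ux Uy; apply: ereal_sup_ubound; exists (x, y). Qed.

Lemma diam_ge0 U x : U x -> 0 <= diam U.
Proof. by move=> Ux; apply: le_trans (diam_ge_dist Ux Ux); rewrite lee_fin. Qed.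

Lemma diam_pow_ge_dist s U x y : (0 <= s)%R -> U x -> U y ->
  (`|x - y|%R `^ s)%:E <= diam_pow s U.
Proof.
move=> s0 Ux Uy; rewrite /diam_pow ifF; last first.
  by apply/negbTE/set0P; exists x.
rewrite -poweR_EFin gt0_ler_poweR// ?diam_ge_dist// in_itv/= ?leey ?andbT.
  by rewrite lee_fin.
exact: diam_ge0 Ux.
Qed.

Lemma diam_pow_fin_num s delta U : diam U <= delta%:E ->
  diam_pow s U \is a fin_num.
Proof.
rewrite /diam_pow => Ud; case: ifPn => // /set0P[x Ux].
rewrite fin_num_poweR// ge0_fin_numE ?(diam_ge0 Ux)//.
by rewrite (le_lt_trans Ud) ?ltry.
Qed.

Lemma hausdorff_premeasure_ge0 s delta E : 0 <= hausdorff_premeasure s delta E.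
Proof.
apply: le_ereal_inf_tmp => _ [U _ <-].
by apply: nneseries_ge0 => n _ _; exact: diam_pow_ge0.
Qed.

(** A lower bound through Lebesgue measure: if [U_i] cover [E], each preimage of
    [U_i] by [g] lies within [C diam(U_i)^s] of any of its points, and the
    resulting intervals, of total length at most [2 C] times the sum of the
    [diam(U_i)^s], cover [[0, 1)]. *)
Lemma hausdorff_measure_gt0 s (C : R) (g : R -> R) E : (0 <= s)%R -> (0 < C)%R ->
  (forall u, (0 <= u < 1)%R -> E (g u)) ->
  (forall u v, (0 <= u < 1)%R -> (0 <= v < 1)%R ->
     (`|u - v| <= C * `|g u - g v| `^ s)%R) ->
  0 < hausdorff_measure s E.
Proof.
move=> s0 C0 gE holder.
suff : ((2 * C)^-1)%:E <= hausdorff_measure s E.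
  by apply: lt_le_trans; rewrite lte_fin invr_gt0 mulr_gt0.
apply: (@le_trans _ _ (hausdorff_premeasure s 1 E)); last first.
  by apply: ereal_sup_ubound; exists 1%R => //=.
apply: le_ereal_inf_tmp => _ [U [EU dU] <-].
(* [S i] is the preimage of [U i] by [g]; [B i] is centred at one of its points,
   and empty if there is none. *)
pose S i := [set u : R | (0 <= u < 1)%R /\ U i (g u)].
pose r i := (C * fine (diam_pow s (U i)))%R.
pose B i : set R := if pselect (S i !=set0) is left ne
  then [set` `[(sval (cid ne) - r i)%R, (sval (cid ne) + r i)%R]] else set0.
have SB i : S i `<=` B i.
  move=> u Su; rewrite /B; case: pselect => [ne|]; last by case; exists u.
  case: cid => c /= [c01 Uc]; case: Su => u01 Uu.
  have h : (`|u - c| <= r i)%R.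
    apply: le_trans (holder _ _ u01 c01) _; rewrite ler_pM2l//.
    rewrite -lee_fin fineK; first exact: diam_pow_ge_dist.
    exact: diam_pow_fin_num (dU i).
  by rewrite in_itv/=; move: h; rewrite ler_distl; lra.
have mB i : measurable (B i) by rewrite /B; case: pselect.
have muB i : lebesgue_measure (B i) <= (2 * C)%:E * diam_pow s (U i).
  rewrite /B; case: pselect => [ne|_]; last first.
    by rewrite measure0 mule_ge0// ?lee_fin ?mulr_ge0 ?diam_pow_ge0// ltW.
  rewrite lebesgue_measure_itv/= lte_fin -EFinB.
  rewrite -(fineK (diam_pow_fin_num s (dU i))) -EFinM.
  have : (0 <= fine (diam_pow s (U i)))%R by rewrite fine_ge0// diam_pow_ge0.
  case: ifPn => _ h; rewrite lee_fin /r; first by lra.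
  by rewrite mulr_ge0// mulr_ge0// ltW.
have cov : `[0%R, 1%R[%classic `<=` \bigcup_i B i.
  move=> u; rewrite /= in_itv/= => u01; have [i _ Ui] := EU _ (gE _ u01).
  by exists i => //; apply: SB.
have := measure_sigma_subadditive lebesgue_measure mB (measurable_itv `[0%R, 1%R[) cov.
rewrite [leLHS](@lebesgue_measure_itv R)/= lte_fin ltr01 sube0 => h.
have {h} : 1 <= (2 * C)%:E * \sum_(0 <= i <oo) diam_pow s (U i).
  rewrite -nneseriesZl; last by move=> i _; exact: diam_pow_ge0.
  by apply: le_trans h _; apply: lee_nneseries => i _.
by rewrite -lee_pdivrMl ?mulr_gt0// mule1.
Qed.

(** Cover by intervals of length [w = 1/N]. Using [2 N] of them instead of [N]
    includes the right end point, at no cost in the limit. *)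
Lemma hausdorff_measure_itv_eq0 s E : (1 < s)%R -> E `<=` `[0%R, 1%R] ->
  hausdorff_measure s E = 0.
Proof.
move=> s1 E01; apply/eqP; rewrite eq_le; apply/andP; split; last first.
  apply: le_trans (hausdorff_premeasure_ge0 s 1 E) _.
  by apply: ereal_sup_ubound; exists 1%R => //=.
apply: ge_ereal_sup => _ [delta /= delta0 <-].
apply/lee_addgt0Pr => e e0; rewrite add0e.
(* [w <= a] makes the intervals shorter than [delta] and the total cost
   [2 N w ^ s = 2 w ^ (s - 1)] at most [e]. *)
pose a := Num.min delta ((e / 2) `^ (s - 1)^-1)%R.
have a0 : (0 < a)%R by rewrite /a lt_min delta0 powR_gt0// divr_gt0.
pose N := (Num.truncn a^-1).+1; pose w : R := (N%:R^-1)%R.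
have w0 : (0 < w)%R by rewrite invr_gt0.
have wa : (w <= a)%R.
  by rewrite /w -[leRHS]invrK lef_pV2 ?posrE ?invr_gt0//; apply/ltW/truncnS_gt.
pose U i : set R :=
  if (i < 2 * N)%N then [set` `[(i%:R * w)%R, (i.+1%:R * w)%R]] else set0.
have dU i : diam (U i) <= w%:E.
  apply: ge_ereal_sup => _ [[x y] /= [Ux Uy] <-]; rewrite lee_fin.
  move: Ux Uy; rewrite /U; case: ifP => //= _.
  rewrite !in_itv/= -natr1 mulrDl mul1r => xi yi; rewrite ler_norml; lra.
apply: (@le_trans _ _ (\sum_(0 <= i <oo) diam_pow s (U i))).
  apply: ereal_inf_lbound; exists U => //; split; last first.
    by move=> i; apply: le_trans (dU i) _; rewrite lee_fin (le_trans wa)// ge_min lexx.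
  move=> x /E01; rewrite /= in_itv/= => /andP[x0 x1].
  have xN0 : (0 <= x * N%:R)%R by rewrite mulr_ge0.
  have /andP[t1 t2] := truncn_itv xN0.
  exists (Num.truncn (x * N%:R)) => //; rewrite /U ifT/=.
    by rewrite in_itv/= ler_pdivrMr// t1 ler_pdivlMr// ltW.
  rewrite truncn_lt_nat// natrM ltr_pM2r// (le_lt_trans x1)// ltr1n//.
rewrite (nneseries_split 0 (2 * N)); last by move=> k _; exact: diam_pow_ge0.
rewrite eseries0 ?adde0 => [|i iN _]; last first.
  by rewrite /U ltnNge -[(2 * N)%N]add0n iN /= /diam_pow eqxx.
apply: (@le_trans _ _ (\sum_(0 <= k < 0 + 2 * N) (w `^ s)%:E)).
  apply: lee_sum => i _; rewrite /diam_pow; case: ifPn => [_|/set0P[x Ux]].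
    by rewrite lee_fin powR_ge0.
  have d0 := diam_ge0 Ux.
  rewrite -poweR_EFin gt0_ler_poweR ?(le_trans _ (ltW s1))// in_itv/= ?leey ?andbT//.
  by rewrite lee_fin ltW.
rewrite sumEFin lee_fin sumr_const_nat subn0 add0n.
rewrite -mulr_natl natrM -mulrA.
have -> : (w `^ s = w * w `^ (s - 1))%R.
  by rewrite mulr_powRB1 ?(ltW w0)// (lt_trans _ s1).
rewrite mulrA mulrA -(mulrA 2%R) divff ?mulr1//.
have : (w `^ (s - 1) <= e / 2)%R.
  apply: (@le_trans _ _ (((e / 2) `^ (s - 1)^-1) `^ (s - 1))%R).
    rewrite ge0_ler_powR ?nnegrE ?powR_ge0 ?(ltW w0)//; first by lra.
    by rewrite (le_trans wa)// ge_min lexx orbT.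
  by rewrite -powRrM mulVf ?powRr1 ?divr_ge0 ?(ltW e0)//; lra.
- by lra.
- by rewrite pnatr_eq0.
Qed.

Lemma hausdorff_dim_eq1 E : E `<=` `[0%R, 1%R] ->
  (forall s, (0 <= s < 1)%R -> 0 < hausdorff_measure s E) ->
  hausdorff_dim E = 1.
Proof.
move=> E01 Epos; apply/eqP; rewrite eq_le; apply/andP; split.
  apply/lee_addgt0Pr => e e0; apply: ereal_inf_lbound; exists (1 + e)%R => //=.
  split; first by lra.
  by apply: hausdorff_measure_itv_eq0 => //; lra.
apply: le_ereal_inf_tmp => _ [s /= [s0 Hs] <-]; rewrite lee_fin leNgt.
apply/negP => s1; have := Epos s; rewrite s0 s1 Hs ltxx => /(_ isT).
by [].
Qed.

End Hausdorff.

(** * Pierce series and their digits *)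

Section Pierce.
Context {R : realType}.
Implicit Types (x : R) (d : nat -> nat).

Lemma pierce_map_lt x : 0 < x -> pierce_map x < x.
Proof.
move=> x0; rewrite /pierce_map /pierce_digit1.
have := floorD1_gt x^-1; rewrite -(ltr_pM2r x0) mulVf ?gt_eqF// intrD mulrDl mul1r.
lra.
Qed.

(** Infinite descent: if [x = p / m] then [pierce_map x = r / m] with an
    integer [r], and [0 < r < p] because [0 < pierce_map x < x]. *)
Lemma irrational_pierce_orbit x :
  (forall n, 0 < iter n pierce_map x) -> irrational x.
Proof.
move=> x_gt0 [q _ qx].
suff nonat (p : nat) (y : R) (m : nat) : (0 < m)%N -> y * m%:R = p%:R ->
    ~ forall n, 0 < iter n pierce_map y.
  have q0 : 0 < q by rewrite -(ltr0q R) qx; exact: (x_gt0 0%N).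
  apply: (nonat `|numq q|%N x `|denq q|%N _ _ x_gt0).
    by rewrite absz_gt0 denq_eq0.
  rewrite -qx /ratr !natr_absz !normr_denq.
  rewrite mulfVK ?intr_eq0 ?denq_eq0// gtr0_norm// ?numq_gt0//.
elim/ltn_ind: p y m => p IH y m m0 yp y_gt0.
have /= Ty0 := y_gt0 1%N.
have m0R : 0 < m%:R :> R by rewrite ltr0n.
pose r : int := m%:Z - pierce_digit1 y * p%:Z.
have rE : pierce_map y * m%:R = r%:~R.
  by rewrite /pierce_map /r rmorphB rmorphM/= -!pmulrn -yp; ring.
have r0 : 0 <= r by rewrite -(ler_int R) -rE mulr_ge0// ltW.
apply: (IH `|r|%N _ (pierce_map y) m) => //.
- rewrite -(ltr_nat R) natr_absz ger0_norm// -rE -yp ltr_pM2r//.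
  exact/pierce_map_lt/(y_gt0 0%N).
- by rewrite rE natr_absz ger0_norm.
- by move=> n; rewrite -iterSr; exact: y_gt0.
Qed.

Definition pierce_term d (k : nat) : R :=
  (-1) ^+ k / \prod_(i < k.+1) (d i)%:R.

Definition pierce_series d : R := limn (series (pierce_term d)).

Lemma pierce_term_le d k : (forall n, (1 < d n)%N) ->
  `|pierce_term d k| <= geometric 2^-1 2^-1 k.
Proof.
move=> d1; rewrite /pierce_term normrM normrX normrN1 expr1n mul1r /=.
rewrite -exprS exprVn normfV lef_pV2 ?posrE ?exprn_gt0//; last first.
  by rewrite normr_gt0; apply/prodf_neq0 => i _; rewrite pnatr_eq0 -lt0n ltnW.
rewrite normr_prod -[X in _ ^+ X]card_ord -prodr_const ler_prod// => i _.
by rewrite ler0n/= normr_nat ler_nat.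
Qed.

Lemma cvg_norm_pierce d : (forall n, (1 < d n)%N) ->
  cvgn [normed series (pierce_term d)].
Proof.
move=> d1; have h : `|2^-1| < 1 :> R by rewrite ger0_norm// invf_lt1// ltr1n.
apply: (series_le_cvg _ _ _ (@is_cvg_geometric_series _ 2^-1 2^-1 h)) => k //=.
exact: pierce_term_le.
Qed.

Lemma pierce_series_le1 d : (forall n, (1 < d n)%N) -> `|pierce_series d| <= 1.
Proof.
move=> d1; have h : `|2^-1| < 1 :> R by rewrite ger0_norm// invf_lt1// ltr1n.
apply: le_trans (lim_series_norm (cvg_norm_pierce d1)) _.
apply: le_trans (@lim_series_le _ _ (geometric 2^-1 2^-1) (cvg_norm_pierce d1)
  (@is_cvg_geometric_series _ 2^-1 2^-1 h) (fun k => pierce_term_le k d1)) _.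
rewrite (cvg_lim _ (@cvg_geometric_series _ 2^-1 2^-1 h))//.
have -> : (1 : R) - 2^-1 = 2^-1 by field.
by rewrite mulfV.
Qed.

(** Factoring [1 / d 0] out of the alternating series. Everything below uses
    the series through this recurrence and the crude bound [pierce_series_le1]
    only. *)
Lemma pierce_series_rec d : (forall n, (1 < d n)%N) ->
  pierce_series d = (1 - pierce_series (fun k => d k.+1)) / (d 0)%:R.
Proof.
move=> d1; have cd := normed_cvg (cvg_norm_pierce d1).
have d1S n : (1 < d n.+1)%N by [].
have cdS := normed_cvg (cvg_norm_pierce d1S).
have d0 : (d 0)%:R != 0 :> R by rewrite pnatr_eq0 -lt0n ltnW.
rewrite [LHS]/pierce_series; apply: cvg_lim => //.
rewrite -(cvg_shiftS (series _)) /=.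
rewrite [X in X @ _ --> _](_ : _ =
    (fun n => (1 - series (pierce_term (fun k => d k.+1)) n) / (d 0)%:R)); last first.
  apply/funext => n; rewrite /series/= big_nat_recl// mulrBl; congr (_ + _).
    by rewrite /pierce_term expr0 big_ord1.
  rewrite mulr_suml -sumrN; apply: eq_bigr => k _; rewrite /pierce_term.
  by rewrite [in LHS]big_ord_recl /= exprS invfM; ring.
by apply: cvgMl; apply: cvgB => //; exact: cvg_cst.
Qed.

(** The lower bound [1 < d 0] excludes expansions starting with the digit [1],
    so that the series is dominated by a geometric one of ratio [1/2]. *)
Definition increasing_digits d := (1 < d 0)%N /\ forall n, (d n < d n.+1)%N.

Lemma increasing_digits_gt1 d n : increasing_digits d -> (1 < d n)%N.
Proof. by case=> d0 dS; elim: n => // n IH; exact: ltn_trans IH (dS n). Qed.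

Lemma increasing_digitsS d :
  increasing_digits d -> increasing_digits (fun k => d k.+1).
Proof.
by move=> dd; split; [exact: increasing_digits_gt1 | move=> n; exact: dd.2].
Qed.

(** The recurrence bootstraps: the crude bound gives nonnegativity, hence
    [x <= 1 / d 0 <= 1/2]; applied to the shifted digits this is strictly below
    [1], which gives positivity, and positivity of the shifted series gives the
    strict upper bound. *)
Lemma pierce_series_itv d : increasing_digits d ->
  0 < pierce_series d < (d 0)%:R^-1.
Proof.
have ge0 e : increasing_digits e -> 0 <= pierce_series e.
  move=> ee; have e1 n := @increasing_digits_gt1 e n ee.
  rewrite pierce_series_rec// divr_ge0// subr_ge0.
  have e1S n : (1 < e n.+1)%N by [].
  by have := pierce_series_le1 e1S; apply: le_trans; exact: ler_norm.
have gt0 e : increasing_digits e -> 0 < pierce_series e.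
  move=> ee; have e1 n := @increasing_digits_gt1 e n ee.
  have /= z0 := ge0 _ (increasing_digitsS (increasing_digitsS ee)).
  have e1S n : (1 < e n.+1)%N by [].
  rewrite (pierce_series_rec e1) divr_gt0// ?ltr0n ?(ltnW (e1 0))//.
  rewrite subr_gt0 (pierce_series_rec e1S) ltr_pdivrMr ?ltr0n ?(ltnW (e1 _))//.
  have : 2 <= (e 1)%:R :> R by rewrite ler_nat.
  lra.
move=> dd; rewrite gt0//=; have d1 n := @increasing_digits_gt1 d n dd.
rewrite pierce_series_rec// -[ltRHS]mul1r ltr_pM2r ?invr_gt0 ?ltr0n ?(ltnW (d1 _))//.
by have := gt0 _ (increasing_digitsS dd); lra.
Qed.

(** [1/x = d 0 / (1 - x')] lies in [[d 0, d 0 + 1)] as soon as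
    [0 < x' < 1 / (d 0 + 1)], and [x' < 1 / d 1] where [d 1 >= d 0 + 1]. *)
Lemma pierce_digit1_series d : increasing_digits d ->
  pierce_digit1 (pierce_series d) = d 0.
Proof.
move=> dd; have d1 n := @increasing_digits_gt1 d n dd.
have /andP[x0 xd] := pierce_series_itv dd.
have /andP[y0 yd] := pierce_series_itv (increasing_digitsS dd).
have d0 : 0 < (d 0)%:R :> R by rewrite ltr0n ltnW.
apply: floor_def; rewrite -[_%:~R]/((d 0)%:R) ; apply/andP; split.
  by rewrite -[leLHS]invrK lef_pV2 ?posrE ?invr_gt0// ltW.
rewrite -[ltRHS]invrK ltf_pV2 ?posrE ?invr_gt0// ?ltr0z//.
rewrite intrD -[(d 0)%:~R]/((d 0)%:R : R).
have dS : (d 0)%:R + 1 <= (d 1)%:R :> R by rewrite natr1 ler_nat; exact: dd.2.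
have yd' : pierce_series (fun k => d k.+1) < ((d 0)%:R + 1)^-1.
  by apply: lt_le_trans yd _; rewrite lef_pV2// posrE; lra.
rewrite pierce_series_rec// ltr_pdivlMr// mulrC ltrBrDl.
have : ((d 0)%:R + 1)^-1 * ((d 0)%:R + 1) = 1 :> R by rewrite mulVf// gt_eqF//; lra.
lra.
Qed.

Lemma pierce_map_series d : increasing_digits d ->
  pierce_map (pierce_series d) = pierce_series (fun k => d k.+1).
Proof.
move=> dd; have d1 n := @increasing_digits_gt1 d n dd.
rewrite /pierce_map pierce_digit1_series// pierce_series_rec//.
by rewrite mulrC divfK ?subKr// pnatr_eq0 -lt0n ltnW.
Qed.

Lemma iter_pierce_map_series d n : increasing_digits d ->
  iter n pierce_map (pierce_series d) = pierce_series (fun k => d (n + k)%N).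
Proof.
elim: n d => [|n IH] d dd //.
by rewrite iterSr pierce_map_series// IH//; exact: increasing_digitsS.
Qed.

Lemma increasing_digits_shift d n :
  increasing_digits d -> increasing_digits (fun k => d (n + k)%N).
Proof.
move=> dd; split; first exact: increasing_digits_gt1.
by move=> k; rewrite addnS; exact: dd.2.
Qed.

Lemma pierce_digit_series d n : increasing_digits d ->
  pierce_digit n.+1 (pierce_series d) = d n.
Proof.
move=> dd; rewrite /pierce_digit iter_pierce_map_series//.
rewrite pierce_digit1_series ?addn0//; exact: increasing_digits_shift.
Qed.

Lemma irrational_pierce_series d :
  increasing_digits d -> irrational (pierce_series d).
Proof.
move=> dd; apply: irrational_pierce_orbit => n.
by rewrite iter_pierce_map_series//;
  have /andP[] := pierce_series_itv (increasing_digits_shift n dd).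
Qed.

(** By the recurrence, prepending the digit [k] is an affine map of slope
    [- 1/k]. *)
Lemma pierce_series_common_prefix d e n :
  increasing_digits d -> increasing_digits e ->
  (forall i, (i < n)%N -> d i = e i) ->
  `|pierce_series d - pierce_series e| =
  `|pierce_series (fun k => d (n + k)%N) - pierce_series (fun k => e (n + k)%N)|
   / \prod_(i < n) (d i)%:R.
Proof.
elim: n d e => [|n IH] d e dd ee de.
  by rewrite big_ord0 invr1 mulr1.
have d1 n := @increasing_digits_gt1 d n dd.
have e1 n := @increasing_digits_gt1 e n ee.
rewrite (pierce_series_rec d1) (pierce_series_rec e1) -de// -mulrBl normrM.
rewrite (_ : _ - _ - _ = - (pierce_series (fun k => d k.+1) -
  pierce_series (fun k => e k.+1))); last by ring.
rewrite normrN (IH (fun k => d k.+1) (fun k => e k.+1)); last 3 first.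
- exact: increasing_digitsS.
- exact: increasing_digitsS.
- by move=> i ni; exact: de.
rewrite big_ord_recl normfV normr_nat invfM mulrA mulrAC; congr (_ / _ / _).
Qed.

(** The first Pierce cell of [e] lies below [1 / (d 0 + 1)], the left end of the
    cell of [d]. A large second digit [d 1] keeps the point of [d] in the right
    part of its cell, at distance [(1 / (d 0 + 1) - x') / d 0] from that end,
    where [x' < 1 / d 1 <= 1 / (2 B)] is at most half of [1 / (d 0 + 1)]. *)
Lemma pierce_series_separation d e (B : R) : increasing_digits d ->
  increasing_digits e -> (d 0 < e 0)%N ->
  (d 0).+1%:R <= B -> 2 * B <= (d 1)%:R ->
  (2 * B ^+ 2)^-1 <= pierce_series d - pierce_series e.
Proof.
move=> dd ee de dSB Bd.
have dB : (d 0)%:R <= B by apply: le_trans dSB; rewrite ler_nat.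
have d1 n := @increasing_digits_gt1 d n dd.
have /andP[_ ye] := pierce_series_itv ee.
have /andP[z0 zd] := pierce_series_itv (increasing_digitsS dd).
have d0 : 0 < (d 0)%:R :> R by rewrite ltr0n ltnW.
have B0 : 0 < B by exact: lt_le_trans d0 dB.
have ye' : pierce_series e <= (d 0).+1%:R^-1.
  by apply/ltW/(lt_le_trans ye); rewrite lef_pV2 ?posrE ?ltr0n ?ler_nat//;
    exact: leq_ltn_trans de.
have z2 : pierce_series (fun k => d k.+1) <= (2 * B)^-1.
  apply/ltW/(lt_le_trans zd); rewrite lef_pV2 ?posrE ?ltr0n ?mulr_gt0//.
  by rewrite ltnW.
rewrite pierce_series_rec//.
have H1 : (d 0).+1%:R^-1 = (1 - (d 0).+1%:R^-1) / (d 0)%:R :> R.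
  by rewrite -natr1; field; rewrite natr1 !pnatr_eq0 -lt0n ltnW.
apply: (@le_trans _ _ ((1 - (2 * B)^-1) / (d 0)%:R - (d 0).+1%:R^-1)); last first.
  by apply: lerB => //; rewrite ler_pM2r ?invr_gt0//; lra.
rewrite {1}H1 -mulrBl.
have : B^-1 <= (d 0).+1%:R^-1 by rewrite lef_pV2 ?posrE ?ltr0n.
rewrite expr2 mulrA invfM => h.
apply: ler_pM; rewrite ?invr_ge0 ?mulr_ge0//; try exact: ltW.
  by rewrite invfM; move: h; set b := B^-1; set c := _.+1%:R^-1; lra.
by rewrite lef_pV2 ?posrE.
Qed.

End Pierce.

(** * Points with digits in geometric windows *)

Section MixedRadix.
Context {R : realType}.
Context (M : nat) (M_ge4 : (4 <= M)%N).
Implicit Types (u v : R).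

(** What is left of [u] after [n] digits in the mixed radix system with bases
    [M, M^2, M^3, ...], rescaled to [[0, 1)]. *)
Fixpoint radix_rem (n : nat) u : R :=
  if n is k.+1 then
    M%:R ^+ k.+1 * radix_rem k u - (Num.truncn (M%:R ^+ k.+1 * radix_rem k u))%:R
  else u.

Definition radix_digit u (n : nat) : nat :=
  Num.truncn (M%:R ^+ n.+1 * radix_rem n u).

Let M_gt0 : 0 < M%:R :> R.
Proof. by rewrite ltr0n; apply: leq_trans M_ge4. Qed.

Lemma radix_remS n u :
  radix_rem n.+1 u = M%:R ^+ n.+1 * radix_rem n u - (radix_digit u n)%:R.
Proof. by []. Qed.

Lemma radix_rem_itv n u : 0 <= u < 1 -> 0 <= radix_rem n u < 1.
Proof.
move=> u01; elim: n => // n /andP[r0 r1]; rewrite radix_remS /radix_digit.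
have p0 : 0 <= M%:R ^+ n.+1 * radix_rem n u by rewrite mulr_ge0// exprn_ge0.
by have := truncn_itv p0; rewrite -natr1; lra.
Qed.

Lemma radix_digit_lt n u : 0 <= u < 1 -> (radix_digit u n < M ^ n.+1)%N.
Proof.
move=> /(radix_rem_itv n)/andP[r0 r1].
rewrite /radix_digit truncn_lt_nat ?mulr_ge0 ?exprn_ge0//.
by rewrite natrX -[ltRHS]mulr1 ltr_pM2l// exprn_gt0.
Qed.

(** The exponent is [1 + 2 + ... + n], as the first [n] bases are
    [M, ..., M^n]. *)
Lemma radix_common_prefix n u v :
  (forall i, (i < n)%N -> radix_digit u i = radix_digit v i) ->
  u - v = (radix_rem n u - radix_rem n v) / M%:R ^+ 'C(n.+1, 2).
Proof.
elim: n => [|n IH] uv; first by rewrite bin_small// expr0 divr1.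
rewrite IH => [|i ni]; last by apply: uv; exact: ltnW.
rewrite !radix_remS uv// (binS n.+1) bin1 exprD.
have Mn k : M%:R ^+ k != 0 :> R by rewrite expf_neq0// gt_eqF.
by field; rewrite !Mn.
Qed.

Lemma dist_radix_common_prefix n u v : 0 <= u < 1 -> 0 <= v < 1 ->
  (forall i, (i < n)%N -> radix_digit u i = radix_digit v i) ->
  `|u - v| <= (M%:R ^+ 'C(n.+1, 2))^-1.
Proof.
move=> /(radix_rem_itv n) ru /(radix_rem_itv n) rv /radix_common_prefix ->.
rewrite normrM normfV (ger0_norm (exprn_ge0 _ (ltW M_gt0))).
rewrite ler_piMl ?invr_ge0 ?exprn_ge0 ?(ltW M_gt0)// ler_norml; lra.
Qed.

Lemma radix_digit_inj u v : 0 <= u < 1 -> 0 <= v < 1 ->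
  radix_digit u =1 radix_digit v -> u = v.
Proof.
move=> u01 v01 uv; apply/eqP; rewrite -subr_eq0 -normr_le0.
apply/ler_addgt0Pr => e e0; rewrite add0r.
pose n := Num.truncn e^-1.
apply: le_trans (dist_radix_common_prefix (n := n) u01 v01 (fun i _ => uv i)) _.
rewrite -[leRHS]invrK lef_pV2 ?posrE ?invr_gt0 ?exprn_gt0//.
apply/ltW/(lt_le_trans (truncnS_gt _)); rewrite -natrX ler_nat -/n.
have nC : (n <= 'C(n.+1, 2))%N by rewrite binS bin1 leq_addl.
apply: (@leq_trans ('C(n.+1, 2)).+1); first by [].
by apply: ltn_expl; apply: leq_trans M_ge4.
Qed.

Definition window_digit u (n : nat) : nat := (M ^ n.+1 + radix_digit u n)%N.

Lemma window_digit_lt n u : 0 <= u < 1 -> (window_digit u n < 2 * M ^ n.+1)%N.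
Proof.
by move=> u01; rewrite mul2n -addnn ltn_add2l radix_digit_lt.
Qed.

Lemma window_digit_increasing u : 0 <= u < 1 -> increasing_digits (window_digit u).
Proof.
move=> u01; split.
  by rewrite /window_digit expn1; apply: leq_trans (leq_addr _ _); apply: leq_trans M_ge4.
move=> n; apply: leq_trans (window_digit_lt n u01) _.
apply: leq_trans (leq_addr _ _); rewrite [leqRHS]expnS leq_mul2r.
by rewrite (leq_trans _ M_ge4) ?orbT.
Qed.

Definition window_point u : R := pierce_series (window_digit u).

Lemma prod_window_digit_le n u : 0 <= u < 1 ->
  (\prod_(i < n) window_digit u i <= M ^ ('C(n.+1, 2) + n))%N.
Proof.
move=> u01; elim: n => [|n IH]; first by rewrite big_ord0 bin_small.
rewrite big_ord_recr/= (binS n.+1) bin1.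
apply: (@leq_trans (M ^ ('C(n.+1, 2) + n) * M ^ n.+2)).
  apply: leq_mul => //; apply: leq_trans (ltnW (window_digit_lt n u01)) _.
  by rewrite [leqRHS]expnS leq_mul2r (leq_trans _ M_ge4) ?orbT.
by rewrite -expnD leq_exp2l; [lia | apply: leq_trans M_ge4].
Qed.

(** The digits of index [n] are below [B = 2 M^(n+1)], and those of index
    [n + 1] are at least [M^(n+2) >= 2 B] because [M >= 4]: the windows are far
    enough apart for [pierce_series_separation]. *)
Lemma window_tail_separation n u v : 0 <= u < 1 -> 0 <= v < 1 ->
  (radix_digit u n < radix_digit v n)%N ->
  (M%:R ^+ (2 * n + 4)%N)^-1 <=
    `|pierce_series (fun k => window_digit u (n + k)) -
      pierce_series (fun k => window_digit v (n + k))| :> R.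
Proof.
move=> u01 v01 uv; apply: le_trans _ (ler_norm _).
have du := window_digit_increasing u01; have dv := window_digit_increasing v01.
pose B := (2 * M ^ n.+1)%N.
have M2 : (2 * B <= M ^ n.+2)%N.
  by rewrite /B mulnA (expnS _ n.+1) leq_mul2r M_ge4 orbT.
apply: (le_trans _ (@pierce_series_separation R _ _ B%:R _ _ _ _ _)).
- rewrite lef_pV2 ?posrE ?mulr_gt0 ?exprn_gt0 ?ltr0n ?muln_gt0 ?expn_gt0 ?(leq_trans _ M_ge4)//.
  (* [2 B ^ 2 = 8 M ^ (2 n + 2)], and [8 <= M ^ 2]. *)
  rewrite -!natrX -natrM ler_nat /B.
  have -> : (2 * n + 4 = 2 + n.+1 * 2)%N by lia.
  rewrite expnD (expnM _ _ 2) expnMn mulnA leq_mul2r.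
  by rewrite (@leq_trans (4 ^ 2))%N ?leq_exp2r ?orbT.
- exact: increasing_digits_shift.
- exact: increasing_digits_shift.
- by rewrite !addn0 ltn_add2l.
- by rewrite addn0 ler_nat window_digit_lt.
- by rewrite -natrM ler_nat addn1 (leq_trans M2)// leq_addr.
Qed.

(** [n] is the index of the first difference between the digits. *)
Lemma window_point_separation u v : 0 <= u < 1 -> 0 <= v < 1 -> u != v ->
  exists n, `|u - v| <= (M%:R ^+ 'C(n.+1, 2))^-1 /\
    (M%:R ^+ ('C(n.+1, 2) + 3 * n + 4)%N)^-1 <= `|window_point u - window_point v|.
Proof.
move=> u01 v01 uv.
have [k kP] : exists k, radix_digit u k != radix_digit v k.
  apply: contrapT => H; move/eqP: uv; apply; apply: radix_digit_inj => // i.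
  by apply/eqP; apply: contrapT => /negP ?; apply: H; exists i.
case: (ex_minnP (ex_intro (fun k => radix_digit u k != radix_digit v k) k kP)).
move=> n nP nmin; exists n.
have pre i : (i < n)%N -> radix_digit u i = radix_digit v i.
  move=> ni; apply/eqP; apply: contrapT => /negP /nmin; lia.
split; first exact: dist_radix_common_prefix.
have du := window_digit_increasing u01; have dv := window_digit_increasing v01.
rewrite /window_point (pierce_series_common_prefix (n := n) du dv); last first.
  by move=> i /pre; rewrite /window_digit => ->.
have p0 : 0 < (\prod_(i < n) window_digit u i)%:R :> R.
  rewrite ltr0n prodn_gt0// => i; exact: ltnW (increasing_digits_gt1 _ du).
have -> : (M%:R ^+ ('C(n.+1, 2) + 3 * n + 4)%N)^-1 =
    (M%:R ^+ (2 * n + 4)%N)^-1 / (M ^ ('C(n.+1, 2) + n))%:R :> R.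
  by rewrite natrX -invfM -exprD; congr (_ ^+ _)^-1; lia.
rewrite -natr_prod; apply: ler_pM.
- by rewrite invr_ge0 exprn_ge0// ltW.
- by rewrite invr_ge0.
- by move: nP; rewrite neq_ltn => /orP[|] ?; [|rewrite distrC]; exact: window_tail_separation.
- rewrite lef_pV2 ?posrE ?ler_nat ?prod_window_digit_le// ltr0n expn_gt0.
  by rewrite (leq_trans _ M_ge4).
Qed.

(** Taking logarithms in base [M], one needs a constant [c] such that
    [P + c >= s (P + 3 n + 4)] with [P = n (n + 1) / 2], for all [n]; it exists
    because the quadratic term [(1 - s) P] beats the linear one. *)
Lemma window_point_holder (s : R) : 0 <= s < 1 ->
  exists2 C : R, 0 < C & forall u v, 0 <= u < 1 -> 0 <= v < 1 ->
    `|u - v| <= C * `|window_point u - window_point v| `^ s.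
Proof.
(* [9 / (2 (1 - s))] is the maximum over all real [n] of [3 n - (1 - s) n ^ 2 / 2], as
   the square in [h1] and [h2] shows. *)
move=> /andP[s0 s1]; pose c := 4 + 9 / (2 * (1 - s)).
exists (M%:R `^ c); first by rewrite powR_gt0.
move=> u v u01 v01; have [->|uv] := eqVneq u v.
  by rewrite subrr normr0 mulr_ge0 ?powR_ge0.
have [n [uvn sep]] := window_point_separation u01 v01 uv.
apply: (le_trans uvn).
apply: (@le_trans _ _ (M%:R `^ c *
    (M%:R ^+ ('C(n.+1, 2) + 3 * n + 4)%N)^-1 `^ s)); last first.
  rewrite ler_pM2l ?powR_gt0// ge0_ler_powR// nnegrE.
  by rewrite invr_ge0 exprn_ge0// ltW.
rewrite -!powR_mulrn ?ler0n// -!powRN -powRrM -powRD; last first.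
  by rewrite (gt_eqF M_gt0) implybT.
apply: ler_powR; first by rewrite (@ler_nat R 1) (leq_trans _ M_ge4).
have CE : 2 * 'C(n.+1, 2)%:R = n%:R * (n%:R + 1) :> R.
  by rewrite -natrM -mul_bin_diag bin1 natrM -natr1 mulrC.
rewrite 2!natrD natrM /c.
have n0 : 0 <= n%:R :> R by [].
move: ('C(n.+1, 2)%:R : R) (n%:R : R) CE n0 => P x CE x0.
have e0 : 0 < 1 - s by lra.
have h1 : 0 <= (1 - s) * (x - 3 / (1 - s)) ^+ 2 by rewrite mulr_ge0 ?sqr_ge0 ?ltW.
have h2 : (1 - s) * (x - 3 / (1 - s)) ^+ 2 =
   (1 - s) * x ^+ 2 - 6 * x + 2 * (9 / (2 * (1 - s))).
  by field; rewrite gt_eqF.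
have h3 : 0 <= (1 - s) * (2 * P - x ^+ 2) by rewrite mulr_ge0//; [lra|rewrite CE; lra].
have h4 : 0 <= (1 - s) * (3 * x + 4) by rewrite mulr_ge0; lra.
nra.
Qed.

End MixedRadix.

Lemma window_point_in_pierce_exp_growth {R : realType} (kappa : R) (M : nat) u :
  (4 <= M)%N -> expR kappa <= M%:R -> 0 <= u < 1 ->
  pierce_exp_growth kappa (window_point M u : R).
Proof.
move=> M4 kM u01; have du := window_digit_increasing M4 u01.
have /andP[x0 x1] := pierce_series_itv (R := R) du.
have M0 : 0 < M%:R :> R by rewrite ltr0n; apply: leq_trans M4.
split; [|exact: irrational_pierce_series|].
  rewrite x0/= (le_trans (ltW x1))// invf_le1 ?ler1n ?ltr0n;
  by rewrite ltnW// increasing_digits_gt1.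
case=> // n _; rewrite pierce_digit_series// -pmulrn.
apply: (@le_trans _ _ (ln (M ^ n.+1)%:R)).
  rewrite natrX lnXn// -[leRHS]mulr_natr ler_wpM2r//.
  by rewrite -ler_expR lnK// posrE.
rewrite ler_ln ?posrE ?ltr0n ?expn_gt0 ?(leq_trans _ M4)//.
  by rewrite ler_nat leq_addr.
by rewrite ltnW// increasing_digits_gt1.
Qed.

(** * Points with exponentially growing digits *)

Local Open Scope ereal_scope.

Theorem theorem1p6 (R : realType) (kappa : R) :
  hausdorff_dim (pierce_exp_growth kappa) = 1.
Proof.
apply: hausdorff_dim_eq1 => [x [/andP[x0 x1] _ _]|s s01].
  by rewrite /= in_itv/= (ltW x0).
pose M := maxn 4 (Num.truncn (expR kappa)).+1.
have M4 : (4 <= M)%N by exact: leq_maxl.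
have kM : (expR kappa <= M%:R)%R.
  by apply: le_trans (ltW (truncnS_gt _)) _; rewrite ler_nat leq_maxr.
have [C C0 holder] := window_point_holder (R := R) M4 s01.
have /andP[s0 _] := s01.
apply: (hausdorff_measure_gt0 s0 C0 _ holder) => u.
exact: window_point_in_pierce_exp_growth.
Qed.
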